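(* Let $n\geq 1$ be an integer, let $\alpha,L>0$, let $p\geq 4$ be an integer and let $\ell\geq 1$ be an integer with $\ell+1<p/2$. Then there exists a constant $c>0$, not depending on $n$ (nor on $\alpha$, $L$ or $\sigma$), such that $$\inf_{\widehat{\psi}_{\ell}}\ \sup_{P_X\in\mathcal P(\alpha,L)}\ \mathbb E\Big[\big\|\widehat{\psi}_{\ell}-\psi_{\ell}(\Gamma_{P_X})\big\|^2\Big]\ \geq\ c,$$ where the infimum is over all estimators, i.e. all measurable functions of the observations $\{Y_i(t_j):1\le i\le n,\,1\le j\le p\}$ taking values in the unit sphere of $\mathbb L^2([0,1])$.
   Context: Observation model: $X_1,\dots,X_n$ are i.i.d. with distribution $P_X\in\mathcal P$, where $\mathcal P$ is the set of distributions on $\mathbb L^2([0,1])$ of centered, mean-square continuous random functions $X$ on $[0,1]$ with $\mathbb E\|X\|^2<\infty$ (taken in an a.s. continuous version). One observes $Y_i(t_j)=X_i(t_j)+\varepsilon_{i,j}$, $i=1,\dots,n$, $j=1,\dots,p$, on the grid $t_j=(j-1)/p$, where $\varepsilon_{i,j}$ are i.i.d. $\mathcal N(0,\sigma^2)$ with $\sigma^2>0$, independent of the $X_i$. The covariance kernel is $K_{P_X}(s,t)=\mathbb E[X(s)X(t)]$ and the covariance operator is $\Gamma_{P_X}f(t)=\int_0^1K_{P_X}(v,t)f(v)\,dv$ on $\mathbb L^2([0,1])$; its eigenvalues are assumed distinct and are denoted $\lambda_1(\Gamma_{P_X})>\lambda_2(\Gamma_{P_X})>\cdots$, with associated unit-norm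 eigenfunctions $\psi_j(\Gamma_{P_X})$. $\|\cdot\|$ is the $\mathbb L^2([0,1])$ norm. For $L>0$ and $\alpha=m+\beta$ with $m\in\{0,1,2,\dots\}$ and $\beta\in(0,1]$, the class $\mathcal P(\alpha,L)$ consists of those $P_X\in\mathcal P$ such that $K_{P_X}$ is $m$ times differentiable and $\big|\partial^m_sK_{P_X}(s,t)-\partial^m_sK_{P_X}(s',t)\big|\le L|s-s'|^\beta$ for all $s,s',t\in[0,1]$. *)

(* Defs.v *)
From HB Require Import structures.
From mathcomp Require Import all_boot all_order all_algebra.
From mathcomp Require Import all_classical all_reals all_analysis.
Set Implicit Arguments. Unset Strict Implicit. Unset Printing Implicit Defensive.
Import Order.TTheory GRing.Theory Num.Theory.
Import numFieldNormedType.Exports.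
Local Open Scope classical_set_scope.
Local Open Scope ring_scope.

Section FPCA.
Context {R : realType}.
Local Notation leb := (@lebesgue_measure R).

Definition I01 : set R := `[0%R, 1%R]%classic.

Definition L2sq (f : R -> R) : \bar R :=
  (\int[leb]_(t in I01) ((f t) ^+ 2)%:E)%E.

Definition inL2 (f : R -> R) : Prop :=
  measurable_fun I01 f /\ (L2sq f < +oo)%E.

Definition cov_op (K : R -> R -> R) (f : R -> R) (t : R) : R :=
  Rintegral leb I01 (fun v => K v t * f v).

Definition is_eigenfun (K : R -> R -> R) (lam : R) (f : R -> R) : Prop :=
  inL2 f /\ L2sq f <> 0%E /\ L2sq (fun t => cov_op K f t - lam * f t) = 0%E.

Definition is_eigenvalue (K : R -> R -> R) (lam : R) : Prop :=
  exists f, is_eigenfun K lam f.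

(** "eigenvalues are distinct": every nonzero eigenvalue is simple *)
Definition simple_eigenvalues (K : R -> R -> R) : Prop :=
  forall lam f g, lam != 0 -> is_eigenfun K lam f -> is_eigenfun K lam g ->
    exists a : R, L2sq (fun t => f t - a * g t) = 0%E.

Definition ell_th_eigenvalue (K : R -> R -> R) (ell : nat) (lam : R) : Prop :=
  0 < lam /\ is_eigenvalue K lam /\
  exists s : seq R, size s = ell.-1 /\ uniq s /\
    forall mu, (is_eigenvalue K mu /\ lam < mu) <-> mu \in s.

Definition ell_th_eigenfun (K : R -> R -> R) (ell : nat) (psi : R -> R) : Prop :=
  exists lam, ell_th_eigenvalue K ell lam /\ is_eigenfun K lam psi /\ L2sq psi = 1%E.

Definition deriv01 (f g : R -> R) : Prop :=
  forall s, s \in `[0%R, 1%R] ->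
    (fun h => h^-1 * (f (s + h) - f s))
      @ within [set h : R | h != 0 /\ (s + h) \in `[0%R, 1%R]] (nbhs 0)
      --> g s.

Definition holder_kernel (alpha L : R) (K : R -> R -> R) : Prop :=
  exists (m : nat) (beta : R), 0 < beta <= 1 /\ alpha = m%:R + beta /\
  exists D : nat -> R -> R -> R,
    (forall s t, s \in `[0%R, 1%R] -> t \in `[0%R, 1%R] -> D 0%N s t = K s t) /\
    (forall k t, (k < m)%N -> t \in `[0%R, 1%R] ->
        deriv01 (fun s => D k s t) (fun s => D k.+1 s t)) /\
    (forall s s' t, s \in `[0%R, 1%R] -> s' \in `[0%R, 1%R] -> t \in `[0%R, 1%R] ->
        `|D m s t - D m s' t| <= L * `|s - s'| `^ beta).

Definition in_class (alpha L : R) (ell : nat) (K : R -> R -> R) : Prop :=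
  holder_kernel alpha L K /\ simple_eigenvalues K /\
  exists lam, ell_th_eigenvalue K ell lam.

Section process.
Context {d : measure_display} {Omega : measurableType d} (P : probability Omega R).

Definition cov_kernel (X : Omega -> R -> R) (s t : R) : R :=
  Rintegral P setT (fun w => X w s * X w t).

Definition admissible_process (X : Omega -> R -> R) : Prop :=
  (forall t, measurable_fun setT (fun w => X w t)) /\
  (forall w, {within `[0%R, 1%R], continuous (X w)}) /\
  (forall t, t \in `[0%R, 1%R] -> P.-integrable setT (fun w => ((X w t) ^+ 2)%:E)) /\
  (forall t, t \in `[0%R, 1%R] -> (\int[P]_w (X w t)%:E = 0)%E) /\
  (forall t, t \in `[0%R, 1%R] ->
     (fun s => Rintegral P setT (fun w => (X w s - X w t) ^+ 2))
       @ within [set s : R | s \in `[0%R, 1%R]] (nbhs t) --> 0) /\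
  (\int[P]_w L2sq (X w) < +oo)%E.

Definition fdd_event (Xi : Omega -> R -> R) (ts : seq R) (B : R -> set R) : set Omega :=
  [set w | forall t, t \in ts -> B t (Xi w t)].

(** Sampling model: X_1..X_n i.i.d. admissible random functions, eps_{ij}
    i.i.d. N(0, sigma^2), all mutually independent (independence of the
    generated sigma-algebras, stated on the generating pi-system of
    finite-dimensional cylinder events). *)
Definition sampling_model (n p : nat) (X : 'I_n -> Omega -> R -> R)
    (eps : 'I_n -> 'I_p -> Omega -> R) (sigma : R) : Prop :=
  (forall i, admissible_process (X i)) /\
  (forall i j, measurable_fun setT (eps i j)) /\
  (forall i j (B : set R), measurable B ->
      P [set w | B (eps i j w)] = normal_prob 0 sigma B) /\
  (forall i i' (ts : seq R) (B : R -> set R), (forall t, measurable (B t)) ->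
      P (fdd_event (X i) ts B) = P (fdd_event (X i') ts B)) /\
  (forall (ts : seq R) (B : 'I_n -> R -> set R) (C : 'I_n -> 'I_p -> set R),
      (forall i t, measurable (B i t)) -> (forall i j, measurable (C i j)) ->
      fine (P ([set w | forall i, fdd_event (X i) ts (B i) w] `&`
               [set w | forall i j, C i j (eps i j w)])) =
      (\prod_(i < n) fine (P (fdd_event (X i) ts (B i)))) *
      \prod_(i < n) \prod_(j < p) fine (P [set w | C i j (eps i j w)])).

(** observations Y_i(t_j) = X_i(t_j) + eps_{ij}, grid t_j = (j-1)/p, j = 1..p
    (here j : 'I_p is 0-based, so t_j = j/p) *)
Definition observations (n p : nat) (X : 'I_n -> Omega -> R -> R)
    (eps : 'I_n -> 'I_p -> Omega -> R) (w : Omega) : 'I_n -> 'I_p -> R :=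
  fun i j => X i w ((j : nat)%:R / p%:R) + eps i j w.

Definition risk (n p : nat) (X : 'I_n -> Omega -> R -> R)
    (eps : 'I_n -> 'I_p -> Omega -> R) (F : ('I_n -> 'I_p -> R) -> R -> R)
    (psi : R -> R) : \bar R :=
  (\int[P]_w L2sq (fun t => (F (observations X eps w) t - psi t)%R))%E.

End process.

Definition obs_time_generators (n p : nat) : set (set (('I_n -> 'I_p -> R) * R)) :=
  [set A | (exists i j (B : set R), measurable B /\ A = [set z | B (z.1 i j)]) \/
           (exists B : set R, measurable B /\ A = [set z | B z.2])].

Definition is_estimator (n p : nat) (F : ('I_n -> 'I_p -> R) -> R -> R) : Prop :=
  (forall B : set R, measurable B ->
     <<s (@obs_time_generators n p) >> [set z | B (F z.1 z.2)]) /\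
  (forall y, inL2 (F y) /\ L2sq (F y) = 1%E).

End FPCA.

(* Main.v *)
(** The process can be made invisible on the grid. The functions
    [sqrt 2 * sin (2 pi p k t)], [k >= 1], are orthonormal, smooth, of mean
    zero, and vanish at every [j / p]; a process spanned by finitely many of
    them has observations equal to the pure noise. Two such processes built
    from disjoint sets of frequencies, with small enough amplitudes to lie in
    the Hölder class, therefore yield the same data while their [ell]-th
    eigenfunctions [psi0], [psi1] are orthogonal unit vectors whatever their
    signs. As [2 = ||psi0 - psi1||^2 <= 2 (||F - psi0||^2 + ||F - psi1||^2)],
    one of the two risks is at least [1 / 2]. *)

Require Import Defs.
From HB Require Import structures.
From mathcomp Require Import all_boot all_order all_algebra.
From mathcomp Require Import all_classical all_reals all_analysis.
From mathcomp Require Import measurable_realfun ring lra.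
Import Order.TTheory GRing.Theory Num.Theory.
Import numFieldNormedType.Exports.
Local Open Scope classical_set_scope.
Local Open Scope ring_scope.

(** * Square-integrable functions on [0, 1] and their inner product *)

Section square_integrable.
Context {R : realType}.
Local Notation leb := (@lebesgue_measure R).
Implicit Types f g h : R -> R.

Lemma measurable_I01 : measurable (@I01 R : set (measurableTypeR R)).
Proof. exact: measurable_itv. Qed.

Lemma lebesgue_I01 : leb (@I01 R) = 1%E.
Proof. by rewrite /I01 lebesgue_measure_itv/= lte_fin ltr01 oppr0 adde0. Qed.

Lemma inL2_integrable_sqr f : inL2 f ->
  leb.-integrable (@I01 R) (EFin \o (fun t => f t ^+ 2)).
Proof.
move=> [mf fin]; apply/integrableP; split.
  exact/measurable_EFinP/measurable_funX.
rewrite [X in (X < _)%E](_ : _ = L2sq f)//; apply: eq_integral => x _.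
by rewrite /= ger0_norm// sqr_ge0.
Qed.

Lemma inL2_integrableM f g : inL2 f -> inL2 g ->
  leb.-integrable (@I01 R) (EFin \o (fun t => f t * g t)).
Proof.
move=> Lf Lg; have [mf _] := Lf; have [mg _] := Lg.
have mI := measurable_I01.
apply: (@le_integrable _ _ _ leb _ mI _
  (EFin \o (fun t => f t ^+ 2 + g t ^+ 2))) => //.
- exact/measurable_EFinP/measurable_funM.
- move=> x _; rewrite /= lee_fin [leRHS]ger0_norm ?addr_ge0 ?sqr_ge0//.
  rewrite normrM -[f x ^+ 2]real_normK ?num_real//.
  rewrite -[g x ^+ 2]real_normK ?num_real//.
  have := normr_ge0 (f x); have := normr_ge0 (g x).
  by have := sqr_ge0 (`|f x| - `|g x|); nra.
- have := integrableD mI (inL2_integrable_sqr f Lf) (inL2_integrable_sqr g Lg).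
  by apply: eq_integrable.
Qed.

Lemma inL2D f g : inL2 f -> inL2 g -> inL2 (fun t => f t + g t).
Proof.
move=> Lf Lg; have [mf _] := Lf; have [mg _] := Lg.
have mI := measurable_I01.
split; first exact: measurable_funD.
apply: (@le_lt_trans _ _
  (\int[leb]_(t in I01) ((2 * f t ^+ 2)%R%:E + (2 * g t ^+ 2)%R%:E))%E).
  apply: ge0_le_integral => //=.
  - by move=> x _; rewrite lee_fin sqr_ge0.
  - exact/measurable_EFinP/measurable_funX/measurable_funD.
  - by apply: emeasurable_funD; apply/measurable_EFinP/measurable_funM => //;
      exact: measurable_funX.
  - by move=> x _; rewrite lee_fin; have := sqr_ge0 (f x - g x); nra.
apply: integrable_lty => //; apply: integrableD => //.
  exact: (integrableZl mI _ (inL2_integrable_sqr _ Lf)).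
exact: (integrableZl mI _ (inL2_integrable_sqr _ Lg)).
Qed.

Lemma inL2Z (c : R) f : inL2 f -> inL2 (fun t => c * f t).
Proof.
move=> Lf; have [mf _] := Lf; have mI := measurable_I01.
split; first exact: measurable_funM.
rewrite [L2sq _](_ : _ = \int[leb]_(t in I01) ((c ^+ 2)%R%:E * (f t ^+ 2)%R%:E))%E;
  last by apply: eq_integral => x _; rewrite -EFinM exprMn.
apply: integrable_lty => //.
exact: (integrableZl mI _ (inL2_integrable_sqr _ Lf)).
Qed.

Lemma inL2B f g : inL2 f -> inL2 g -> inL2 (fun t => f t - g t).
Proof.
move=> Lf /(inL2Z (-1)) Lg; have := inL2D _ _ Lf Lg.
by under eq_fun do rewrite mulN1r.
Qed.

Lemma inL2_bounded (M : R) f : measurable_fun (@I01 R) f ->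
  (forall t, `|f t| <= M) -> inL2 f.
Proof.
move=> mf fM; split=> //; have mI := measurable_I01.
apply: (@le_lt_trans _ _ (\int[leb]_(t in I01) (cst (M ^+ 2)%:E t))%E).
  apply: ge0_le_integral => //=.
  - by move=> x _; rewrite lee_fin sqr_ge0.
  - exact/measurable_EFinP/measurable_funX.
  - move=> x _; rewrite lee_fin -[f x ^+ 2]real_normK ?num_real//.
    by rewrite lerXn2r ?nnegrE ?(le_trans _ (fM x)).
by rewrite integral_cst//= [X in (_ * X)%E]lebesgue_I01 mule1 ltry.
Qed.

Lemma inL2_sum (N : nat) (F : 'I_N -> R -> R) : (forall k, inL2 (F k)) ->
  inL2 (fun t => \sum_k F k t).
Proof.
move=> LF; elim: N F LF => [|N IH] F LF.
  under eq_fun do rewrite big_ord0.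
  by apply: (inL2_bounded 0) => // t; rewrite normr0.
under eq_fun do rewrite big_ord_recr/=.
by apply: inL2D => //; exact: IH.
Qed.

(** Acts on functions, not on classes modulo null sets: equality in L2 is expressed below as [ip] of
    a difference with itself being 0. *)
Definition ip f g : R := Rintegral leb (@I01 R) (fun t => f t * g t).

Lemma ipC f g : ip f g = ip g f.
Proof. by apply: eq_Rintegral => t _; rewrite mulrC. Qed.

Lemma ipDl f g h : inL2 f -> inL2 g -> inL2 h ->
  ip (fun t => f t + g t) h = ip f h + ip g h.
Proof.
move=> Lf Lg Lh; rewrite /ip -RintegralD//.
- by apply: eq_Rintegral => t _; rewrite mulrDl.
- exact: measurable_I01.
- exact: inL2_integrableM.
- exact: inL2_integrableM.
Qed.

Lemma ipZl (c : R) f g : inL2 f -> inL2 g ->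
  ip (fun t => c * f t) g = c * ip f g.
Proof.
move=> Lf Lg; rewrite /ip -RintegralZl//.
- by apply: eq_Rintegral => t _; rewrite mulrA.
- exact: measurable_I01.
- exact: inL2_integrableM.
Qed.

Lemma ipBl f g h : inL2 f -> inL2 g -> inL2 h ->
  ip (fun t => f t - g t) h = ip f h - ip g h.
Proof.
move=> Lf Lg Lh; rewrite /ip -RintegralB//.
- by apply: eq_Rintegral => t _; rewrite mulrBl.
- exact: measurable_I01.
- exact: inL2_integrableM.
- exact: inL2_integrableM.
Qed.

Lemma ip_suml (N : nat) (c : 'I_N -> R) (F : 'I_N -> R -> R) g :
  (forall k, inL2 (F k)) -> inL2 g ->
  ip (fun t => \sum_k c k * F k t) g = \sum_k c k * ip (F k) g.
Proof.
move=> LF Lg; elim: N c F LF => [|N IH] c F LF.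
  rewrite big_ord0 -[RHS](mul0r (ip g g)) -ipZl//; congr (ip _ g).
  by apply/funext => t; rewrite big_ord0 mul0r.
rewrite big_ord_recr/= -IH// -ipZl// -ipDl//.
- by congr (ip _ g); apply/funext => t; rewrite big_ord_recr.
- by apply: inL2_sum => k; exact: inL2Z.
- exact: inL2Z.
Qed.

Lemma L2sqE f : inL2 f -> L2sq f = (ip f f)%:E.
Proof.
move=> Lf; rewrite /ip /Rintegral fineK.
  by apply: eq_integral => t _; rewrite expr2.
by apply: integrable_fin_num;
  [exact: measurable_I01|exact: inL2_integrableM].
Qed.

Lemma ip_ge0 f : 0 <= ip f f.
Proof. by apply: Rintegral_ge0 => t _; rewrite -expr2 sqr_ge0. Qed.

(* The degenerate case of Cauchy-Schwarz: it replaces every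
   almost-everywhere argument about null functions. *)
Lemma ip_null f g : inL2 f -> inL2 g -> ip f f = 0 -> ip f g = 0.
Proof.
move=> Lf Lg f0; pose a := ip f g; pose b := ip g g.
have H (x : R) : 0 <= 2 * x * a + x ^+ 2 * b.
  have Lxg := inL2Z x _ Lg; have Lfx := inL2D _ _ Lf Lxg.
  have := ip_ge0 (fun t => f t + x * g t).
  rewrite ipDl// ipZl// (ipC f) (ipC g) !ipDl// !ipZl//.
  by rewrite f0 (ipC g f) -/a -/b; congr (_ <= _); ring.
have b0 : 0 <= b := ip_ge0 g.
(* The minimizer of the quadratic would be [- a / b]; using [b + 1] avoids dividing by zero, and the
   value [- a ^+ 2 * (b + 2) / (b + 1) ^+ 2] still forces [a = 0]. *)
have := H (- a / (b + 1)).
have b1 : b + 1 != 0 by rewrite gt_eqF// ltr_wpDl.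
have -> : 2 * (- a / (b + 1)) * a + (- a / (b + 1)) ^+ 2 * b =
  - (a ^+ 2 * ((b + 2) / (b + 1) ^+ 2)) by field.
rewrite oppr_ge0 pmulr_lle0; last first.
  by rewrite divr_gt0 ?exprn_gt0 ?ltr_wpDl.
move=> a2; apply/eqP; rewrite -sqrf_eq0 -/a.
by rewrite eq_le a2 sqr_ge0.
Qed.

End square_integrable.

(** * The orthonormal sine functions *)

Section sine_basis.
Context {R : realType}.
Local Notation leb := (@lebesgue_measure R).

Definition wave (a : nat) (t : R) : R :=
  Num.sqrt 2 * sin (a%:R * (pi *+ 2) * t).

Lemma sin_2pi_nat (n : nat) : sin (n%:R * (pi *+ 2)) = 0 :> R.
Proof.
elim: n => [|n IH]; first by rewrite mul0r sin0.
by rewrite -natr1 mulrDl mul1r sinD2pi.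
Qed.

Lemma cos_2pi_nat (n : nat) : cos (n%:R * (pi *+ 2)) = 1 :> R.
Proof.
elim: n => [|n IH]; first by rewrite mul0r cos0.
by rewrite -natr1 mulrDl mul1r cosD2pi.
Qed.

(** At [j / p] the phase is [k * j] full turns. This is what hides the process from the
    observations. *)
Lemma wave_grid (p k j : nat) : (0 < p)%N -> wave (p * k) (j%:R / p%:R) = 0.
Proof.
move=> p0; rewrite /wave.
have -> : (p * k)%:R * (pi *+ 2) * (j%:R / p%:R) = (k * j)%:R * (pi *+ 2) :> R.
  by rewrite !natrM; field; rewrite pnatr_eq0 -lt0n.
by rewrite sin_2pi_nat mulr0.
Qed.

Lemma continuous_wave a : continuous (wave a).
Proof.
move=> t; apply: cvgM; first exact: cvg_cst.
apply: continuous_comp; last exact: continuous_sin.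
by apply: cvgM; [exact: cvg_cst|exact: cvg_id].
Qed.

Lemma measurable_wave a (D : set R) : measurable_fun D (wave a).
Proof.
apply: measurable_funTS; apply: continuous_measurable_fun.
exact: continuous_wave.
Qed.

Lemma wave_le2 a t : `|wave a t| <= 2.
Proof.
rewrite normrM ger0_norm ?sqrtr_ge0// -[leRHS]mulr1 ler_pM ?sqrtr_ge0//.
  by have := sqr_sqrtr (ler0n R 2); have := sqrtr_ge0 (2 : R); nra.
exact: sin_max.
Qed.

Lemma inL2_wave a : inL2 (wave a).
Proof. by apply: (inL2_bounded 2) => [|t]; [exact: measurable_wave|exact: wave_le2]. Qed.

Lemma Rintegral_derive01 (f F : R -> R) : continuous f ->
  (forall x : R, is_derive x 1 F (f x)) -> Rintegral leb (@I01 R) f = F 1 - F 0.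
Proof.
move=> cf dF; rewrite /Rintegral /I01.
have cF : continuous F.
  move=> x; apply: differentiable_continuous; apply/derivable1_diffP.
  exact: (@ex_derive _ _ _ _ _ _ _ (dF x)).
rewrite (@continuous_FTC2 _ f F)//.
- exact: continuous_subspaceT.
- split.
  + by move=> x _; exact: (@ex_derive _ _ _ _ _ _ _ (dF x)).
  + exact/cvg_at_right_filter/cF.
  + exact/cvg_at_left_filter/cF.
- by move=> x _; rewrite derive1E; apply: derive_val.
Qed.

Lemma continuous_cosM (c : R) : continuous (fun t => cos (c * t)).
Proof.
move=> t; apply: continuous_comp; last exact: continuous_cos.
by apply: cvgM; [exact: cvg_cst|exact: cvg_id].
Qed.

Lemma Rintegral_cos (n : nat) : (0 < n)%N ->
  Rintegral leb (@I01 R) (fun t => cos (n%:R * (pi *+ 2) * t)) = 0.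
Proof.
move=> n0; pose c : R := n%:R * (pi *+ 2).
have c0 : c != 0.
  by rewrite gt_eqF// mulr_gt0 ?ltr0n// pmulrn_lgt0// pi_gt0.
have dF (x : R) : is_derive x 1 (fun t => c^-1 * sin (c * t)) (cos (c * x)).
  by apply: is_derive_eq; rewrite /GRing.scale/=; field.
rewrite (Rintegral_derive01 _ _ (continuous_cosM c) dF).
by rewrite !mulr1 mulr0 sin0 sin_2pi_nat !mulr0 subr0.
Qed.

Lemma Rintegral_wave (a : nat) : (0 < a)%N -> Rintegral leb (@I01 R) (wave a) = 0.
Proof.
move=> n0; pose c : R := a%:R * (pi *+ 2).
have c0 : c != 0.
  by rewrite gt_eqF// mulr_gt0 ?ltr0n// pmulrn_lgt0// pi_gt0.
have dF (x : R) :
    is_derive x 1 (fun t => - (Num.sqrt 2 / c) * cos (c * t)) (wave a x).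
  by apply: is_derive_eq; rewrite /wave -/c /GRing.scale/=; field.
rewrite (Rintegral_derive01 _ _ (continuous_wave a) dF).
by rewrite !mulr1 mulr0 cos0 cos_2pi_nat subrr.
Qed.

(** The product is the difference of the cosines of frequencies [a - b] and [a + b]. A cosine of
    positive integer frequency integrates to 0, so only the case [a = b], where the first cosine is
    constantly 1, contributes. Assuming [b <= a] makes the subtraction in [nat] exact. *)
Lemma wave_orthonormal (a b : nat) : (0 < a)%N -> (0 < b)%N ->
  ip (wave a) (wave b) = (a == b)%:R.
Proof.
wlog ab : a b / (b <= a)%N.
  move=> H a0 b0; case/orP: (leq_total a b) => ab; last exact: H.
  by rewrite ipC H// eq_sym.
move=> a0 b0; rewrite /ip.
have mI := @measurable_I01 R.
pose C (n : nat) (t : R) : R := cos (n%:R * (pi *+ 2) * t).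
have E (t : R) : wave a t * wave b t = C (a - b)%N t - C (a + b)%N t.
  rewrite /wave /C natrB// natrD !mulrBl !mulrDl cosB cosD.
  by rewrite mulrACA -expr2 sqr_sqrtr//; ring.
have iC n : leb.-integrable (@I01 R) (EFin \o C n).
  apply: continuous_compact_integrable; first exact: segment_compact.
  exact/continuous_subspaceT/continuous_cosM.
transitivity (Rintegral leb I01 (fun t => C (a - b)%N t - C (a + b)%N t)).
  by apply: eq_Rintegral => t _; rewrite E.
rewrite RintegralB//= (Rintegral_cos (a + b)) ?addn_gt0 ?a0// subr0.
have [<-|neq] := eqVneq a b.
  rewrite subnn; transitivity (Rintegral leb I01 (cst 1)).
    by apply: eq_Rintegral => t _; rewrite /C !mul0r cos0.
  by rewrite Rintegral_cst// [X in fine X]lebesgue_I01 mul1r.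
by rewrite Rintegral_cos// subn_gt0 ltn_neqAle eq_sym neq.
Qed.

Lemma ip_wave_sum (N : nat) (e : 'I_N -> nat) (c : 'I_N -> R) (k : 'I_N) :
  injective e -> (forall k, (0 < e k)%N) ->
  ip (fun t => \sum_j c j * wave (e j) t) (wave (e k)) = c k.
Proof.
move=> inj e0; rewrite ip_suml; last exact: inL2_wave; last first.
  by move=> j; exact: inL2_wave.
rewrite (bigD1 k)//= wave_orthonormal// eqxx mulr1 big1 ?addr0// => j jk.
by rewrite wave_orthonormal// (inj_eq inj) (negbTE jk) mulr0.
Qed.

Lemma ip_wave_sum2 (N : nat) (e : 'I_N -> nat) (c d : 'I_N -> R) :
  injective e -> (forall k, (0 < e k)%N) ->
  ip (fun t => \sum_j c j * wave (e j) t) (fun t => \sum_j d j * wave (e j) t) =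
  \sum_j c j * d j.
Proof.
move=> inj e0; rewrite ip_suml.
- by apply: eq_bigr => j _; rewrite ipC ip_wave_sum.
- by move=> j; exact: inL2_wave.
- by apply: inL2_sum => j; exact/inL2Z/inL2_wave.
Qed.

End sine_basis.

(** * Spectrum of a finite-rank sine kernel *)

Section sine_kernel.
Context {R : realType} {N : nat}.
Variables (e : 'I_N -> nat) (lam : 'I_N -> R).
Hypotheses (inj_e : injective e) (e_gt0 : forall k, (0 < e k)%N).
Implicit Types f g : R -> R.

(** A finite Mercer expansion, with eigenvalues [lam k] and eigenfunctions [wave (e k)]. *)
Definition sine_kernel (s t : R) : R :=
  \sum_k lam k * (wave (e k) s * wave (e k) t).

Lemma cov_op_sine_kernel f : inL2 f -> cov_op sine_kernel f =
  fun t => \sum_k (lam k * ip (wave (e k)) f) * wave (e k) t.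
Proof.
move=> Lf; apply/funext => t.
have -> : cov_op sine_kernel f t =
    ip (fun v => \sum_k (lam k * wave (e k) t) * wave (e k) v) f.
  apply: eq_Rintegral => v _; congr (_ * f v).
  by apply: eq_bigr => k _; ring.
rewrite ip_suml//; last by move=> k; exact: inL2_wave.
by apply: eq_bigr => k _; ring.
Qed.

Lemma inL2_cov_op_sine_kernel f : inL2 f -> inL2 (cov_op sine_kernel f).
Proof.
move=> Lf; rewrite cov_op_sine_kernel//.
by apply: inL2_sum => k; exact/inL2Z/inL2_wave.
Qed.

Lemma is_eigenfun_wave k : is_eigenfun sine_kernel (lam k) (wave (e k)).
Proof.
have Lw := @inL2_wave R (e k).
split=> //; split.
  by rewrite L2sqE// wave_orthonormal// eqxx => -[] /eqP; rewrite oner_eq0.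
rewrite cov_op_sine_kernel//.
rewrite (_ : (fun t => _) = fun t => 0 * wave (e k) t); last first.
  apply/funext => t; rewrite mul0r (bigD1 k)//= wave_orthonormal// eqxx mulr1.
  rewrite big1 ?addr0 ?subrr// => j jk.
  by rewrite wave_orthonormal// (inj_eq inj_e) (negbTE jk) mulr0 mul0r.
by have L0 := inL2Z 0 _ Lw; rewrite L2sqE// ipZl// mul0r.
Qed.

Hypothesis inj_lam : injective lam.

(** Let [c j] be the coefficient of [f] on [wave (e j)]. Testing the eigenvalue equation against the
    waves gives [lam j * c j = mu * c j], and against [f] it gives
    [mu * ip f f = \sum_j lam j * c j * c j]. Since [f] is not null, some [c k] is nonzero, whence
    [mu = lam k]. Injectivity of [lam] kills the other coefficients, so [ip f f = c k ^+ 2] and the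
    residual has norm 0. *)
Lemma eigenfun_sine_kernel (mu : R) f : mu != 0 ->
  is_eigenfun sine_kernel mu f -> exists k : 'I_N,
  [/\ mu = lam k, ip (wave (e k)) f != 0 &
      ip (fun t => f t - ip (wave (e k)) f * wave (e k) t)
         (fun t => f t - ip (wave (e k)) f * wave (e k) t) = 0].
Proof.
move=> mu0 [Lf [f0 Kf]].
have Lw j := @inL2_wave R (e j).
pose c j := ip (wave (e j)) f.
have LK := inL2_cov_op_sine_kernel _ Lf.
have Lmf := inL2Z mu _ Lf.
(* Weak form of the eigenvalue equation: the defect has norm 0, hence is orthogonal to every [g]. *)
have eigen g : inL2 g -> ip (cov_op sine_kernel f) g = mu * ip f g.
  move=> Lg; apply/eqP; rewrite -subr_eq0 -ipZl// -ipBl//; apply/eqP.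
  apply: ip_null => //; first exact: inL2B.
  by apply: EFin_inj; rewrite -L2sqE//; exact: inL2B.
have eigen_coef j : lam j * c j = mu * c j.
  by rewrite {2}/c (ipC _ f) -eigen// cov_op_sine_kernel// ip_wave_sum.
have eigen_norm : mu * ip f f = \sum_j lam j * c j * c j.
  by rewrite -eigen// cov_op_sine_kernel// ip_suml.
have [k ck] : exists k, c k != 0.
  apply/existsP; apply: contra_notT f0; rewrite negb_exists => /forallP c0.
  rewrite L2sqE//; congr EFin; apply: (mulfI mu0).
  rewrite mulr0 eigen_norm big1// => j _.
  by have := c0 j; rewrite negbK => /eqP ->; rewrite mulr0.
have muE : mu = lam k by have := eigen_coef k => /(mulIf ck).
have cj j : j != k -> c j = 0.
  move=> jk; apply/eqP; have := eigen_coef j => /eqP; rewrite -subr_eq0 -mulrBl.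
  by rewrite muE mulf_eq0 subr_eq0 (inj_eq inj_lam) (negbTE jk).
have ff : ip f f = c k ^+ 2.
  apply: (mulfI mu0); rewrite eigen_norm (bigD1 k)//= big1 ?addr0.
    by rewrite muE expr2 mulrA.
  by move=> j jk; rewrite cj// mulr0.
exists k; split=> //; have Lcw := inL2Z (c k) _ (Lw k).
rewrite -/(c k); pose r t := f t - c k * wave (e k) t.
have Lr : inL2 r by exact: inL2B.
have rE g : inL2 g -> ip r g = ip f g - c k * ip (wave (e k)) g.
  by move=> Lg; rewrite ipBl// ipZl.
rewrite -/r rE// (ipC f) (ipC (wave _)) !rE//.
by rewrite (ipC f (wave _)) -/(c k) ff wave_orthonormal// eqxx mulr1; ring.
Qed.

(** Up to null functions, [f] and [g] are multiples [a] and [b] of the same wave, so [f - a / b * g]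
    is a combination of two null residuals. *)
Lemma simple_eigenvalues_sine_kernel : simple_eigenvalues sine_kernel.
Proof.
move=> mu f g mu0 ef eg.
have [k [muk fk f0]] := eigenfun_sine_kernel _ _ mu0 ef.
have [j [muj gj g0]] := eigenfun_sine_kernel _ _ mu0 eg.
have kj : j = k by apply: inj_lam; rewrite -muk -muj.
subst j; have [Lf _] := ef; have [Lg _] := eg.
have Lw := @inL2_wave R (e k).
move: f0 g0 fk gj; set a := ip _ f; set b := ip _ g => f0 g0 a0 b0.
exists (a / b).
have Lu : inL2 (fun t => f t - a * wave (e k) t) by exact/inL2B/inL2Z.
have Lv : inL2 (fun t => g t - b * wave (e k) t) by exact/inL2B/inL2Z.
have Lv' := inL2Z (a / b) _ Lv.
have -> : (fun t => f t - a / b * g t) =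
    (fun t => (f t - a * wave (e k) t) - a / b * (g t - b * wave (e k) t)).
  by apply/funext => t; field.
have Ld := inL2B _ _ Lu Lv'.
rewrite L2sqE// ipBl// ipZl//.
by rewrite (ip_null _ _ Lu Ld f0) (ip_null _ _ Lv Ld g0) mulr0 subrr.
Qed.

End sine_kernel.

(** * Membership of sine kernels in the Hölder class *)

Section sine_kernel_class.
Context {R : realType}.

Lemma ell_th_eigenvalue_sine_kernel (N : nat) (e : 'I_N.+1 -> nat)
    (lam : 'I_N.+1 -> R) :
  injective e -> (forall k, (0 < e k)%N) -> (forall k, 0 < lam k) ->
  (forall j k : 'I_N.+1, (j < k)%N -> lam k < lam j) ->
  ell_th_eigenvalue (sine_kernel e lam) N.+1 (lam ord_max).
Proof.
move=> inj_e e0 lam0 dec_lam.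
have inj_lam : injective lam.
  move=> j k jk; apply/val_inj; case: (ltngtP j k) => // /dec_lam.
    by rewrite jk ltxx.
  by rewrite jk ltxx.
split=> //; split; first by exists (wave (e ord_max)); exact: is_eigenfun_wave.
(* The rank equals the index sought, so the eigenvalues above the smallest one are exactly those of
   the other indices. *)
exists [seq lam (lift ord_max k) | k <- enum 'I_N]; split.
  by rewrite size_map size_enum_ord.
split.
  by rewrite map_inj_uniq ?enum_uniq// => j k /inj_lam /lift_inj.
move=> mu; split.
  move=> [[f ef] lt_mu].
  have mu0 : mu != 0 by rewrite gt_eqF// (lt_trans _ lt_mu).
  have [k [muk _ _]] := eigenfun_sine_kernel _ _ inj_e e0 inj_lam _ _ mu0 ef.
  case: (unliftP ord_max k) => [j kj|kmax].
    by apply/mapP; exists j; rewrite ?mem_enum// -kj.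
  by move: lt_mu; rewrite muk kmax ltxx.
move=> /mapP[j _ ->]; split.
  by exists (wave (e (lift ord_max j))); exact: is_eigenfun_wave.
by apply: dec_lam; rewrite lift_max.
Qed.

(** The two-sided derivative is a limit over [h != 0]; restricting further to [s + h] in [0, 1]
    keeps the limit. *)
Lemma deriv01_is_derive (f g : R -> R) :
  (forall s : R, is_derive s 1 f (g s)) -> deriv01 f g.
Proof.
move=> fg s _; have [/cvg_ex[l fl] fgs] := fg s.
have -> : g s = l.
  by rewrite -fgs; exact/cvg_lim.
apply: cvg_trans; last exact: fl.
apply: (@cvg_trans _ ((fun h => h^-1 *: (f (h *: 1 + s) - f s)) @
    within [set h : R | h != 0 /\ (s + h) \in `[0%R, 1%R]] (nbhs 0))).
  rewrite (_ : (fun h => h^-1 *: (f (h *: 1 + s) - f s)) =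
    (fun h => h^-1 * (f (s + h) - f s)))//.
  by apply/funext => h; rewrite [h *: 1]mulr1 (addrC h).
by apply: cvg_app; apply: within_subset => h [].
Qed.

Lemma sin_lipschitz (x y : R) : `|sin x - sin y| <= `|x - y|.
Proof.
wlog xy : x y / y <= x.
  move=> H; have [|/ltW] := leP y x; first exact: H.
  by move=> /H; rewrite distrC (distrC y).
have [c _ ->] := @MVT_segment R sin cos y x xy (fun z _ => is_derive_sin z)
  (continuous_subspaceT (@continuous_sin R)).
by rewrite normrM ler_piMl// cos_max.
Qed.

(** Turns a Lipschitz bound on [0, 1] into a Hölder bound of exponent [b]. *)
Lemma le_powR1 (x b : R) : 0 <= x <= 1 -> 0 < b <= 1 -> x <= x `^ b.
Proof.
move=> /andP[x0 x1] /andP[b0 b1].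
move: x0; rewrite le_eqVlt => /predU1P[<-|x0]; first exact: powR_ge0.
by rewrite -{1}(powRr1 (ltW x0)) ger_powR// x0.
Qed.

(** As [b] ranges over (0, 1], an integer [alpha] must be split as [(alpha - 1) + 1]; otherwise [m]
    is the integer part. *)
Lemma holder_exponent (alpha : R) : 0 < alpha ->
  exists (m : nat) (b : R), 0 < b <= 1 /\ alpha = m%:R + b.
Proof.
move=> a0; have /andP[le_n lt_n] := truncn_itv (ltW a0).
move: le_n; rewrite le_eqVlt => /predU1P[aE|gt_n].
  case: (Num.truncn alpha) aE => [|n] aE; first by rewrite -aE ltxx in a0.
  by exists n, 1; rewrite ltr01 lexx -aE natr1.
exists (Num.truncn alpha), (alpha - (Num.truncn alpha)%:R).
by rewrite subr_gt0 gt_n lerBlDr addrC natr1 ltW//; split=> //; rewrite addrC subrK.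
Qed.

(** The [n]-th derivative of [wave a]; the phase shift by [n] quarter turns avoids alternating
    between sine and cosine. *)
Definition wave_deriv (n a : nat) (s : R) : R :=
  Num.sqrt 2 * ((a%:R * (pi *+ 2)) ^+ n * sin (a%:R * (pi *+ 2) * s + n%:R * (pi / 2))).

Lemma is_derive_wave_deriv n a (s : R) :
  is_derive s 1 (wave_deriv n a) (wave_deriv n.+1 a s).
Proof.
rewrite /wave_deriv; apply: is_derive_eq.
rewrite /GRing.scale/= -(natr1 n) (mulrDl n%:R) mul1r addrA sinDpihalf exprS.
by ring.
Qed.

Lemma wave_deriv_lipschitz n a (s s' : R) :
  `|wave_deriv n a s - wave_deriv n a s'| <=
  2 * (a%:R * (pi *+ 2)) ^+ n.+1 * `|s - s'|.
Proof.
have c0 : 0 <= a%:R * (pi *+ 2) :> R by rewrite mulr_ge0// mulrn_wge0 ?pi_ge0.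
rewrite /wave_deriv -mulrBr -mulrBr !normrM ger0_norm ?sqrtr_ge0//.
rewrite -[leRHS]mulrA ler_pM ?sqrtr_ge0 ?mulr_ge0 ?normr_ge0//.
  by have := sqr_sqrtr (ler0n R 2); have := sqrtr_ge0 (2 : R); nra.
rewrite ger0_norm ?exprn_ge0// exprSr -[leRHS]mulrA ler_wpM2l ?exprn_ge0//.
apply: (le_trans (sin_lipschitz _ _)).
by rewrite opprD addrACA subrr addr0 -mulrBr normrM (ger0_norm c0).
Qed.

(** Differentiation is in [s] only. In each summand the factor 4 is 2, bounding the wave in [t],
    times 2, bounding the [sqrt 2] in the Lipschitz constant of the [m]-th derivative. The sum is
    thus [L]-Lipschitz in [s], hence Hölder on [0, 1]. *)
Lemma holder_sine_kernel (N : nat) (e : 'I_N -> nat) (lam : 'I_N -> R)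
    (alpha L b : R) (m : nat) :
  (forall k, 0 <= lam k) -> 0 < b <= 1 -> alpha = m%:R + b ->
  \sum_k lam k * (4 * ((e k)%:R * (pi *+ 2)) ^+ m.+1) <= L ->
  holder_kernel alpha L (sine_kernel e lam).
Proof.
move=> lam0 b01 alphaE ML; exists m, b; split=> //; split=> //.
exists (fun n s t => \sum_k (lam k * wave (e k) t) * wave_deriv n (e k) s); split.
  move=> s t _ _; apply: eq_bigr => k _.
  by rewrite /wave_deriv /wave mul0r addr0 expr0 mul1r; ring.
split.
  move=> n t _ _; apply: deriv01_is_derive => s.
  have := @is_derive_sum R _ _ N
    (fun k s => (lam k * wave (e k) t) * wave_deriv n (e k) s) s 1
    (fun k => (lam k * wave (e k) t) * wave_deriv n.+1 (e k) s).
  rewrite fct_sumE; apply => k.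
  have dk := is_derive_wave_deriv n (e k) s.
  by apply: is_derive_eq; rewrite /GRing.scale/=; ring.
move=> s s' t; rewrite !in_itv/= => /andP[s0 s1] /andP[s'0 s'1] _.
rewrite -sumrB; apply: (@le_trans _ _ (L * `|s - s'|)); last first.
  have M0 : 0 <= L.
    apply: le_trans ML; apply: sumr_ge0 => k _; rewrite mulr_ge0// mulr_ge0//.
    by rewrite exprn_ge0// mulr_ge0// mulrn_wge0 ?pi_ge0.
  rewrite ler_wpM2l//; apply: le_powR1 => //.
  by rewrite normr_ge0 ler_norml; apply/andP; split; lra.
apply: (@le_trans _ _ (\sum_k
    lam k * (4 * ((e k)%:R * (pi *+ 2)) ^+ m.+1) * `|s - s'|)); last first.
  by rewrite -mulr_suml ler_wpM2r.
apply: (le_trans (ler_norm_sum _ _ _)); apply: ler_sum => k _.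
rewrite -mulrBr normrM [`|lam k * _|]normrM (ger0_norm (lam0 k)).
rewrite -[leLHS]mulrA -[leRHS]mulrA ler_wpM2l//.
apply: (le_trans (ler_pM (normr_ge0 _) (normr_ge0 _) (wave_le2 _ _)
  (wave_deriv_lipschitz _ _ _ _))).
by rewrite le_eqVlt; apply/orP; left; apply/eqP; ring.
Qed.

End sine_kernel_class.

(** * Independent random variables with prescribed laws *)

Section independent_families.
Context {R : realType}.

(** Induction on [s]: each new index multiplies the space by one more real line carrying its law,
    and its variable reads that coordinate. The start is a point mass, where the condition on the
    empty list is vacuous. *)
Lemma independent_seq (I : eqType)
    (mu : I -> probability (measurableTypeR R) R) (s : seq I) : uniq s ->
  exists (d : measure_display) (T : measurableType d)
         (P : probability T R) (Z : I -> T -> R),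
    (forall i, measurable_fun setT (Z i)) /\
    forall A : I -> set R, (forall i, measurable (A i)) ->
      P [set w | forall i, i \in s -> A i (Z i w)] =
      (\prod_(i <- s) fine (mu i (A i)))%:E.
Proof.
elim: s => [_|i s IH /= /andP[i_s us]].
  exists _, _, (@dirac _ (measurableTypeR R) 0 R), (fun _ _ => 0).
  split=> // A mA; rewrite big_nil.
  rewrite (_ : [set _ | _] = setT); first exact: probability_setT.
  by apply/seteqP; split=> w.
have [d [T [P [Z [mZ PZ]]]]] := IH us.
exists _, (T * measurableTypeR R)%type, (P \x mu i)%E,
  (fun j w => if j == i then w.2 else Z j w.1); split.
  move=> j; case: (j == i); first exact: measurable_snd.
  exact: (measurableT_comp (mZ j) measurable_fst).
move=> A mA; pose B := [set w | forall j, j \in s -> A j (Z j w)]; have sE :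
    [set w : T * measurableTypeR R | forall j, j \in i :: s ->
       A j (if j == i then w.2 else Z j w.1)] =
    B `*` A i.
  apply/seteqP; split=> [w /= H|w /= [H Ai] j].
    split; last by have := H i; rewrite mem_head eqxx; exact.
    move=> j js; have := H j; rewrite in_cons js orbT => /(_ isT).
    by case: eqP js => // ->; rewrite (negbTE i_s).
  by rewrite in_cons; case: eqP => [->|_ /=]; [|exact: H].
have mB : measurable B.
  rewrite (_ : B = \bigcap_(j in [set` s]) (Z j @^-1` A j)); last first.
    by apply/seteqP; split=> w /= H j; exact: H.
  apply: fin_bigcap_measurable; first exact: finite_seq.
  by move=> j _; rewrite -[X in measurable X]setTI; exact: mZ.
transitivity ((P \x mu i)%E (B `*` A i)); first by rewrite -sE.
transitivity (P B * mu i (A i))%E; first exact: (product_measure1E P (mu i) mB (mA i)).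
rewrite (PZ A mA : P B = _) big_cons mulrC EFinM fineK//.
by apply: fin_num_measure; exact: mA.
Qed.

Lemma independent_family (I : finType)
    (mu : I -> probability (measurableTypeR R) R) :
  exists (d : measure_display) (T : measurableType d)
         (P : probability T R) (Z : I -> T -> R),
    (forall i, measurable_fun setT (Z i)) /\
    forall A : I -> set R, (forall i, measurable (A i)) ->
      P [set w | forall i, A i (Z i w)] = (\prod_i fine (mu i (A i)))%:E.
Proof.
have [d [T [P [Z [mZ PZ]]]]] := independent_seq I mu (index_enum I)
  (index_enum_uniq I).
exists d, T, P, Z; split=> // A mA; rewrite -PZ//; congr (P _).
by apply/seteqP; split=> w /= H i; [move=> _; exact: H|exact: H (mem_index_enum i)].
Qed.

(** Take the whole line as the event of every other index. *)
Lemma independent_family_law (I : finType)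
    (mu : I -> probability (measurableTypeR R) R) (d : measure_display)
    (T : measurableType d) (P : probability T R) (Z : I -> T -> R) :
  (forall A : I -> set R, (forall i, measurable (A i)) ->
      P [set w | forall i, A i (Z i w)] = (\prod_i fine (mu i (A i)))%:E) ->
  forall i (B : set R), measurable B -> P [set w | B (Z i w)] = mu i B.
Proof.
move=> PZ i B mB; have := PZ (fun j => if j == i then B else setT).
rewrite (_ : [set w | forall j, _] = [set w | B (Z i w)]); last first.
  apply/seteqP; split=> w /= H; first by have := H i; rewrite eqxx.
  by move=> j; case: eqP => [->|].
move=> ->; last by move=> j; case: ifP.
rewrite (bigD1 i)//= eqxx big1 ?mulr1; last first.
  by move=> j /negbTE ->; rewrite probability_setT.
by rewrite fineK//; exact: fin_num_measure.
Qed.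

(** Turns expectations in a uniform variable into integrals over [0, 1], so that moments reduce to
    [ip]. Splitting into positive and negative parts spares any integrability assumption. *)
Lemma integral_uniform01 {d : measure_display} {T : measurableType d}
    {P : probability T R} {U : T -> R} :
  measurable_fun setT U ->
  (forall B : set R, measurable B ->
     P [set w | B (U w)] = uniform_prob (@ltr01 R) B) ->
  forall g : R -> R, measurable_fun setT g ->
  (\int[P]_w (g (U w))%:E = \int[lebesgue_measure]_(x in I01) (g x)%:E)%E.
Proof.
move=> mU lawU g mg.
have ge0_case (f : R -> \bar R) : measurable_fun setT f -> (forall x, 0 <= f x)%E ->
    (\int[P]_w f (U w) = \int[lebesgue_measure]_(x in I01) f x)%E.
  move=> mf f0.
  transitivity (\int[pushforward P (U : T -> measurableTypeR R)]_y f y)%E.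
    by rewrite ge0_integral_pushforward.
  transitivity (\int[uniform_prob (@ltr01 R)]_y f y)%E.
    by apply: eq_measure_integral => A mA _; exact: lawU.
  by rewrite integral_uniform// subr0 invr1 mul1e.
rewrite integralE [RHS]integralE; congr (_ - _)%E.
  rewrite -ge0_case//; last exact/measurable_funepos/measurable_EFinP.
  by apply: eq_integral => w _; rewrite !funeposE.
rewrite -ge0_case//; last exact/measurable_funeneg/measurable_EFinP.
by apply: eq_integral => w _; rewrite !funenegE.
Qed.

End independent_families.

(** * A process driven by one uniform variable *)

Section sine_process.
Context {R : realType} {N : nat}.
Variables (e : 'I_N -> nat) (b : 'I_N -> R).
Hypotheses (inj_e : injective e) (e_gt0 : forall k, (0 < e k)%N).

(* With [u] uniform on [0, 1], the values [wave (e k) u] are themselves the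
   centered, uncorrelated scores of the expansion in [t]. *)
Definition sine_process (u t : R) : R :=
  \sum_k b k * (wave (e k) u * wave (e k) t).

Lemma sine_processE u :
  sine_process u = fun t => \sum_k (b k * wave (e k) u) * wave (e k) t.
Proof. by apply/funext => t; apply: eq_bigr => k _; rewrite mulrA. Qed.

(** Lets facts about the time variable serve for the random one. *)
Lemma sine_processC u t : sine_process u t = sine_process t u.
Proof. by apply: eq_bigr => k _; rewrite (mulrC (wave _ u)). Qed.

Lemma continuous_sum_ord (n : nat) (F : 'I_n -> R -> R) :
  (forall k, continuous (F k)) -> continuous (fun t => \sum_k F k t).
Proof.
elim: n F => [|n IH] F cF.
  rewrite (_ : (fun _ => _) = cst 0); first by move=> t; exact: cvg_cst.
  by apply/funext => t; rewrite big_ord0.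
rewrite (_ : (fun t => _) =
  fun t => (\sum_(k < n) F (widen_ord (leqnSn n) k) t) + F ord_max t).
  by move=> t; apply: cvgD; [exact: IH|exact: cF].
by apply/funext => t; rewrite big_ord_recr.
Qed.

Lemma continuous_sine_process u : continuous (sine_process u).
Proof.
rewrite sine_processE; apply: continuous_sum_ord => k t.
by apply: cvgM; [exact: cvg_cst|exact: continuous_wave].
Qed.

Lemma measurable_sine_process t : measurable_fun setT (sine_process^~ t).
Proof.
rewrite (_ : sine_process^~ t = sine_process t).
  apply: continuous_measurable_fun; exact: continuous_sine_process.
by apply/funext => u; rewrite sine_processC.
Qed.

Lemma inL2_sine_process u : inL2 (sine_process u).
Proof.
by rewrite sine_processE; apply: inL2_sum => k; exact/inL2Z/inL2_wave.
Qed.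

Lemma ip_sine_process u v : ip (sine_process u) (sine_process v) =
  sine_kernel e (fun k => b k ^+ 2) u v.
Proof.
rewrite !sine_processE ip_wave_sum2//.
by apply: eq_bigr => k _; ring.
Qed.

Context (d : measure_display) (T : measurableType d) (P : probability T R).
Variable U : T -> R.
Hypotheses (mU : measurable_fun setT U)
  (lawU : forall B : set R, measurable B ->
    P [set w | B (U w)] = uniform_prob (@ltr01 R) B).

(** The expectation is an integral over [u]; by symmetry it is the inner product of [sine_process s]
    and [sine_process t], which orthonormality evaluates. The eigenvalues are therefore the squared
    amplitudes. *)
Lemma cov_kernel_sine_process s t :
  cov_kernel P (fun w => sine_process (U w)) s t =
  sine_kernel e (fun k => b k ^+ 2) s t.
Proof.
rewrite -ip_sine_process /cov_kernel /ip /Rintegral; congr fine.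
rewrite -(integral_uniform01 mU lawU
  (fun u => sine_process s u * sine_process t u)).
  by apply: eq_integral => w _; rewrite (sine_processC s) (sine_processC t).
by apply: measurable_funM; apply: continuous_measurable_fun;
  exact: continuous_sine_process.
Qed.

(** The mean is the inner product with the constant 1, and every wave of positive frequency is
    orthogonal to it. *)
Lemma integral_sine_process t :
  (\int[P]_w (sine_process (U w) t)%:E = 0)%E.
Proof.
rewrite (integral_uniform01 mU lawU (sine_process^~ t))//; last first.
  exact: measurable_sine_process.
have L1 : inL2 (cst (1 : R)).
  by apply: (inL2_bounded 1) => // x; rewrite normr1.
have ip0 : ip (sine_process t) (cst 1) = 0.
  rewrite sine_processE ip_suml//; last by move=> k; exact: inL2_wave.
  rewrite big1// => k _.
  have -> : ip (wave (e k)) (cst 1) = Rintegral (@lebesgue_measure R) (@I01 R) (wave (e k)).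
    by apply: eq_Rintegral => x _; rewrite mulr1.
  by rewrite Rintegral_wave// mulr0.
rewrite -[RHS]/(0%:E) -ip0 /ip /Rintegral fineK.
  by apply: eq_integral => x _; rewrite mulr1 sine_processC.
by apply: integrable_fin_num; [exact: measurable_I01|
  apply: inL2_integrableM => //; exact: inL2_sine_process].
Qed.

(** Parseval for the increment, a sine sum in [u]. The right side is visibly continuous in [s] and
    vanishes at [s = t], which gives mean-square continuity. *)
Lemma mean_square_increment s t :
  Rintegral P setT (fun w => (sine_process (U w) s - sine_process (U w) t) ^+ 2) =
  \sum_k (b k * wave (e k) s - b k * wave (e k) t) ^+ 2.
Proof.
transitivity (ip
   (fun u => \sum_k (b k * wave (e k) s - b k * wave (e k) t) * wave (e k) u)
   (fun u => \sum_k (b k * wave (e k) s - b k * wave (e k) t) * wave (e k) u)).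
  have E u : sine_process u s - sine_process u t =
      \sum_k (b k * wave (e k) s - b k * wave (e k) t) * wave (e k) u.
    by rewrite -sumrB; apply: eq_bigr => k _; ring.
  rewrite /ip /Rintegral; congr fine.
  rewrite -(integral_uniform01 mU lawU (fun u =>
    (\sum_k (b k * wave (e k) s - b k * wave (e k) t) * wave (e k) u) *
    (\sum_k (b k * wave (e k) s - b k * wave (e k) t) * wave (e k) u))).
    by apply: eq_integral => w _; rewrite E expr2.
  by apply: measurable_funM; apply: continuous_measurable_fun;
    apply: continuous_sum_ord => k x;
    (apply: cvgM; [exact: cvg_cst|exact: continuous_wave]).
by rewrite ip_wave_sum2//; apply: eq_bigr => k _; rewrite expr2.
Qed.

Lemma admissible_sine_process :
  admissible_process P (fun w => sine_process (U w)).
Proof.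
have mX t : measurable_fun setT (fun w => sine_process (U w) t).
  exact: (measurableT_comp (measurable_sine_process t) mU).
split=> //; split.
  by move=> w; exact/continuous_subspaceT/continuous_sine_process.
split.
  move=> t _; apply/integrableP; split.
    exact/measurable_EFinP/measurable_funX.
  apply: (@le_lt_trans _ _ (L2sq (sine_process t))); last first.
    by have [] := inL2_sine_process t.
  rewrite /L2sq -(integral_uniform01 mU lawU (fun u => sine_process t u ^+ 2)).
    rewrite le_eqVlt; apply/orP; left; apply/eqP; apply: eq_integral => w _.
    by rewrite /= ger0_norm ?sqr_ge0// sine_processC.
  apply: measurable_funX; apply: continuous_measurable_fun.
  exact: continuous_sine_process.
split; first by move=> t _; exact: integral_sine_process.
split.
  move=> t _; under eq_fun do rewrite mean_square_increment.
  apply: cvg_within_filter.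
  have C : continuous (fun s => \sum_k (b k * wave (e k) s - b k * wave (e k) t) ^+ 2).
    apply: continuous_sum_ord => k x; under eq_fun do rewrite expr2.
    have cx : {for x, continuous (fun s => b k * wave (e k) s - b k * wave (e k) t)}.
      apply: cvgB; last exact: cvg_cst.
      by apply: cvgM; [exact: cvg_cst|exact: continuous_wave].
    exact: cvgM.
  have := C t; rewrite /continuous_at [X in _ --> X -> _](_ : _ = 0)//.
  by rewrite big1// => k _; rewrite subrr expr0n.
have L2E u : L2sq (sine_process u) =
    (sine_kernel e (fun k => b k ^+ 2) u u)%:E.
  by rewrite L2sqE ?ip_sine_process//; exact: inL2_sine_process.
under eq_integral do rewrite L2E.
(* The squared norm of a path is the kernel on the diagonal, bounded by a constant because each wave
   is at most 2 in absolute value. *)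
apply: (@le_lt_trans _ _ (\int[P]_w (cst (\sum_k b k ^+ 2 * 4)%:E w))%E).
  apply: ge0_le_integral => //=.
  - by move=> w _; rewrite -L2E; apply: integral_ge0 => x _; rewrite lee_fin sqr_ge0.
  - apply/measurable_EFinP.
    apply: (measurableT_comp (f := fun u => sine_kernel e _ u u)) => //.
    apply: continuous_measurable_fun; apply: continuous_sum_ord => k x.
    apply: cvgM; first exact: cvg_cst.
    by apply: cvgM; exact: continuous_wave.
  - move=> w _; rewrite lee_fin; apply: ler_sum => k _.
    rewrite ler_wpM2l ?sqr_ge0// -expr2 -real_normK ?num_real//.
    by have := wave_le2 (e k) (U w); have := normr_ge0 (wave (e k) (U w)); nra.
by rewrite integral_cst//= probability_setT mule1 ltry.
Qed.

End sine_process.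

(** * Measurability and a lower bound for the estimation error *)

Section estimation_error.
Context {R : realType} {d : measure_display} {T : measurableType d}.
Local Notation leb := (@lebesgue_measure R).

(** The sets with measurable preimage under [phi] form a sigma-algebra containing the generators,
    hence all of the generated one. *)
Lemma measurable_estimator (n p : nat) (F : ('I_n -> 'I_p -> R) -> R -> R)
    (eps : 'I_n -> 'I_p -> T -> R) :
  is_estimator F -> (forall i j, measurable_fun setT (eps i j)) ->
  measurable_fun setT
    (fun z : T * measurableTypeR R => F (fun i j => eps i j z.1) z.2).
Proof.
move=> [mF _] meps _ B mB; rewrite setTI.
pose phi (z : T * measurableTypeR R) := ((fun i j => eps i j z.1), (z.2 : R)).
have H : sigma_algebra setT [set A | measurable (phi @^-1` A)].
  split=> /=.
  - by rewrite preimage_set0.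
  - by move=> A mA; rewrite setTD preimage_setC; exact: measurableC.
  - by move=> A mA; rewrite preimage_bigcup; exact: bigcup_measurable.
have := mF B mB; rewrite -/(phi @^-1` [set z | B (F z.1 z.2)]).
move=> /(_ _ (conj H _)); apply => A /= [[i [j [C [mC ->]]]]|[C [mC ->]]].
  rewrite (_ : _ @^-1` _ = setT `&` (fun z => eps i j z.1) @^-1` C).
    exact: (measurableT_comp (meps i j) measurable_fst).
  by rewrite setTI.
rewrite (_ : _ @^-1` _ = setT `&` snd @^-1` C).
  exact: measurable_snd.
by rewrite setTI.
Qed.

(** By Tonelli, integrating a jointly measurable nonnegative function over [t] leaves a measurable
    function of [w]. *)
Lemma measurable_estimation_error (n p : nat)
    (F : ('I_n -> 'I_p -> R) -> R -> R) (eps : 'I_n -> 'I_p -> T -> R)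
    (psi : R -> R) :
  is_estimator F -> (forall i j, measurable_fun setT (eps i j)) -> inL2 psi ->
  measurable_fun setT
    (fun w => L2sq (fun t => F (fun i j => eps i j w) t - psi t)).
Proof.
move=> eF meps [mpsi _]; have mI := @measurable_I01 R.
(* [psi] is known to be measurable on [0, 1] only, hence its restriction; the indicator lets the
   integral run over the whole line. *)
pose G (z : T * measurableTypeR R) : \bar R :=
  (((F (fun i j => eps i j z.1) z.2 - (psi \_ I01) z.2) ^+ 2) * \1_I01 z.2)%:E.
have mG : measurable_fun setT G.
  apply/measurable_EFinP; apply: measurable_funM.
    apply: measurable_funX; apply: measurable_funB.
      exact: (measurable_estimator n p F eps eF meps).
    apply: (measurableT_comp (f := psi \_ I01) _ measurable_snd).
    exact: (measurable_restrictT psi mI).1.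
  have m1 : measurable_fun setT (\1_(@I01 R) : measurableTypeR R -> R).
    exact: measurable_indic.
  exact: (measurableT_comp m1 measurable_snd).
have G0 z : (0 <= G z)%E by rewrite lee_fin mulr_ge0 ?sqr_ge0.
have := measurable_fun_fubini_tonelli_F (m2 := leb) G mG G0.
rewrite (_ : fubini_F leb G =
  fun w => L2sq (fun t => F (fun i j => eps i j w) t - psi t))//.
apply/funext => w; rewrite /fubini_F /L2sq [RHS]integral_mkcond.
apply: eq_integral => t _; rewrite /G /= !patchE indicE.
by case: ifPn => _; rewrite ?mulr1 ?mulr0.
Qed.

(** Parallelogram identity for [f - g] and [f - h], dropping the squared norm of their sum. *)
Lemma L2sq_dist_le (f g h : R -> R) : inL2 f -> inL2 g -> inL2 h ->
  (L2sq (fun t => (g t - h t)%R) <=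
   2%:E * (L2sq (fun t => (f t - g t)%R) + L2sq (fun t => (f t - h t)%R)))%E.
Proof.
move=> Lf Lg Lh.
have Lgh := inL2B _ _ Lg Lh; have Lfg := inL2B _ _ Lf Lg.
have Lfh := inL2B _ _ Lf Lh; have Ls := inL2D _ _ Lfg Lfh.
rewrite !L2sqE// -EFinD -EFinM lee_fin.
have E u : inL2 u -> ip (fun t => g t - h t) u =
    ip (fun t => f t - h t) u - ip (fun t => f t - g t) u.
  by move=> Lu; rewrite !ipBl//; ring.
have S u : inL2 u -> ip (fun t => f t - g t + (f t - h t)) u =
    ip (fun t => f t - g t) u + ip (fun t => f t - h t) u.
  by move=> Lu; rewrite ipDl.
have := ip_ge0 (fun t => f t - g t + (f t - h t)).
rewrite S// (ipC _ (fun t => f t - g t + _)) (ipC (fun t => f t - h t)) !S//.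
rewrite E// (ipC _ (fun t => g t - h t)) (ipC (fun t => f t - g t) (fun t => g t - h t)) !E//.
rewrite (ipC (fun t => f t - g t) (fun t => f t - h t)).
set x := ip _ _; set y := ip _ _; set z := ip _ _.
lra.
Qed.

(** For each outcome the squared distance 2 between [psi0] and [psi1] is at most twice the sum of
    the two errors; integrate over total mass 1. *)
Lemma two_point_bound (n p : nat) (F : ('I_n -> 'I_p -> R) -> R -> R)
    (P : probability T R) (eps : 'I_n -> 'I_p -> T -> R) (psi0 psi1 : R -> R) :
  is_estimator F -> (forall i j, measurable_fun setT (eps i j)) ->
  inL2 psi0 -> inL2 psi1 -> ip psi0 psi0 = 1 -> ip psi1 psi1 = 1 ->
  ip psi0 psi1 = 0 ->
  (1 <= \int[P]_w L2sq (fun t => (F (fun i j => eps i j w) t - psi0 t)%R) +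
        \int[P]_w L2sq (fun t => (F (fun i j => eps i j w) t - psi1 t)%R))%E.
Proof.
move=> eF meps L0 L1 n0 n1 o01.
have L2sq_ge0 f : (0 <= L2sq f :> \bar R)%E.
  by apply: integral_ge0 => t _; rewrite lee_fin sqr_ge0.
rewrite -ge0_integralD//; try exact: measurable_estimation_error.
apply: (@le_trans _ _ (\int[P]_w (cst 1%E w))%E).
  by rewrite integral_cst//= probability_setT mule1.
apply: ge0_le_integral => //.
  by apply: emeasurable_funD; exact: measurable_estimation_error.
move=> w _ /=; have [LF _] := eF.2 (fun i j => eps i j w).
have := L2sq_dist_le _ _ _ LF L0 L1.
have L01 := inL2B _ _ L0 L1.
rewrite (L2sqE (fun t => psi0 t - psi1 t))//.
rewrite !ipBl// (ipC psi0) (ipC psi1) !ipBl// (ipC psi1 psi0) n0 n1 o01.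
set x := (_ + _)%E; rewrite subr0 sub0r opprK => H.
by rewrite -(@lee_pmul2l _ 2%:E)// mule1.
Qed.

End estimation_error.

(** * The sampling model attached to a set of frequencies *)

Section sine_model.
Context {R : realType}.

(** Amplitudes proportional to [N - k] are positive and strictly decreasing for [k < N]. Scaling
    their squares by [L / (S + 1)] turns the weighted sum [S] into [L * S / (S + 1)]; the [+ 1]
    covers [S = 0]. *)
Lemma exists_amplitudes (N : nat) (M : 'I_N -> R) (L : R) :
  0 < L -> (forall k, 0 <= M k) ->
  exists b : 'I_N -> R,
    [/\ forall k, 0 < b k ^+ 2,
        forall j k : 'I_N, (j < k)%N -> b k ^+ 2 < b j ^+ 2 &
        \sum_k b k ^+ 2 * M k <= L].
Proof.
move=> L0 M0; pose a (k : 'I_N) : R := (N - k)%:R.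
pose S := \sum_k a k ^+ 2 * M k.
have S0 : 0 <= S by apply: sumr_ge0 => k _; rewrite mulr_ge0 ?sqr_ge0.
have S1 : 0 < S + 1 by rewrite ltr_wpDl.
have c0 : 0 < L / (S + 1) by rewrite divr_gt0.
have bE (k : 'I_N) : (Num.sqrt (L / (S + 1)) * a k) ^+ 2 = L / (S + 1) * a k ^+ 2.
  by rewrite exprMn sqr_sqrtr// ltW.
have a0 k : 0 < a k by rewrite ltr0n subn_gt0.
exists (fun k => Num.sqrt (L / (S + 1)) * a k); split=> [k|j k jk|].
- by rewrite bE mulr_gt0// exprn_gt0.
- rewrite !bE ltr_pM2l// ltrXn2r ?nnegrE ?ltW//.
  by rewrite ltr_nat ltn_sub2l.
- under eq_bigr do rewrite bE -mulrA.
  rewrite -mulr_sumr -/S mulrAC ler_pdivrMr// ler_wpM2l ?ltW//.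
  by rewrite ltrDl.
Qed.

Variables (n p : nat) (sigma : R).
Context {d : measure_display} {T : measurableType d}.
Variables (P : probability T R) (Z : 'I_n + 'I_n * 'I_p -> T -> R).
(** Index [inl i] is the uniform variable driving the [i]-th curve, [inr (i, j)] the noise at its
    [j]-th grid point. *)
Let mu (k : 'I_n + 'I_n * 'I_p) : probability (measurableTypeR R) R :=
  if k is inl _ then uniform_prob (@ltr01 R) else normal_prob 0 sigma.
Hypotheses (mZ : forall k, measurable_fun setT (Z k))
  (PZ : forall A, (forall k, measurable (A k)) ->
     P [set w | forall k, A k (Z k w)] = (\prod_k fine (mu k (A k)))%:E).

(** A cylinder event of a curve is an event [A ts B] of its uniform variable, so the required
    product formula is that of the family [Z]. *)
Lemma sampling_model_sine_process (N : nat) (e : 'I_N -> nat) (b : 'I_N -> R) :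
  injective e -> (forall k, (0 < e k)%N) ->
  sampling_model P (fun i w => sine_process e b (Z (inl i) w))
    (fun i j => Z (inr (i, j))) sigma.
Proof.
move=> inj_e e0; have lawZ := independent_family_law _ mu _ _ P Z PZ.
pose A (ts : seq R) (B : R -> set R) : set R :=
  [set u | forall t, t \in ts -> B t (sine_process e b u t)].
have mA ts B : (forall t, measurable (B t)) -> measurable (A ts B).
  move=> mB; rewrite (_ : A ts B =
      \bigcap_(t in [set` ts]) ((sine_process e b)^~ t @^-1` B t)).
    apply: fin_bigcap_measurable; first exact: finite_seq.
    move=> t _; rewrite -[X in measurable X]setTI.
    by apply: measurable_sine_process.
  by apply/seteqP; split=> u H t; exact: H.
have PA i ts B : (forall t, measurable (B t)) ->
    P (fdd_event (fun w => sine_process e b (Z (inl i) w)) ts B) =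
    mu (inl i) (A ts B).
  by move=> mB; rewrite -(lawZ (inl i))//; exact: mA.
split; first by move=> i; apply: admissible_sine_process => // B; exact: (lawZ (inl i)).
split; first by [].
split; first by move=> i j B; exact: (lawZ (inr (i, j))).
split; first by move=> i i' ts B mB; rewrite !PA.
move=> ts B C mB mC.
pose D (k : 'I_n + 'I_n * 'I_p) : set R :=
  match k with inl i => A ts (B i) | inr ij => C ij.1 ij.2 end.
transitivity (fine (P [set w | forall k, D k (Z k w)])).
  congr (fine (P _)); apply/seteqP; split=> w /=.
    by move=> [HB HC] [i|[i j]]; [exact: HB|exact: HC].
  by move=> H; split=> [i|i j]; [exact: (H (inl i))|exact: (H (inr (i, j)))].
rewrite PZ; last by case=> [i|[i j]]; [exact: mA|exact: mC].
rewrite /= big_sumType/=; congr (_ * _).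
  by apply: eq_bigr => i _; rewrite PA.
rewrite pair_big/=; apply: eq_bigr => -[i j] _ /=.
by rewrite (lawZ (inr (i, j))).
Qed.

(** [P] and [Z] are fixed beforehand, so models with different frequencies share the same noise. The
    last clause covers every choice of eigenfunction, sign included; which frequency it has is left
    open, since disjoint frequency sets will suffice. *)
Lemma sine_model_exists (N : nat) (e : 'I_N.+1 -> nat) (alpha L : R) :
  injective e -> (forall k, (0 < e k)%N) -> (0 < p)%N ->
  (forall k, (p %| e k)%N) -> 0 < alpha -> 0 < L ->
  exists (X : 'I_n -> T -> R -> R) (K : R -> R -> R),
    [/\ sampling_model P X (fun i j => Z (inr (i, j))) sigma,
        (forall i s t, cov_kernel P (X i) s t = K s t),
        in_class alpha L N.+1 K,
        (forall i w j, X i w (j%:R / p%:R) = 0) &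
        (forall psi, ell_th_eigenfun K N.+1 psi ->
           [/\ inL2 psi, ip psi psi = 1 &
            exists (k : 'I_N.+1) (c : R),
              ip (fun t => psi t - c * wave (e k) t)
                 (fun t => psi t - c * wave (e k) t) = 0])].
Proof.
move=> inj_e e0 p0 pe alpha0 L0.
have [m [beta [beta01 alphaE]]] := holder_exponent _ alpha0.
have [|b [b0 b_dec bL]] := exists_amplitudes N.+1
  (fun k => 4 * ((e k)%:R * (pi *+ 2)) ^+ m.+1) L L0.
  by move=> k; rewrite mulr_ge0// exprn_ge0// mulr_ge0// mulrn_wge0// pi_ge0.
have b_inj : injective (fun k => b k ^+ 2).
  move=> j k /= jk; apply/val_inj; case: (ltngtP j k) => // /b_dec.
    by rewrite jk ltxx.
  by rewrite jk ltxx.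
have lawZ := independent_family_law _ mu _ _ P Z PZ.
exists (fun i w => sine_process e b (Z (inl i) w)),
  (sine_kernel e (fun k => b k ^+ 2)); split.
- exact: sampling_model_sine_process.
- by move=> i s t; apply: cov_kernel_sine_process => // B; exact: (lawZ (inl i)).
- split.
    apply: (holder_sine_kernel _ e _ alpha L beta m _ beta01 alphaE bL) => k.
    by rewrite ltW.
  split; first exact: simple_eigenvalues_sine_kernel.
  by exists (b ord_max ^+ 2); exact: ell_th_eigenvalue_sine_kernel.
- move=> i w j; rewrite /sine_process big1// => k _.
  by have /dvdnP[q ->] := pe k; rewrite mulnC wave_grid// !mulr0.
- move=> psi [lam [[lam0 _] [epsi psi1]]]; have [Lpsi _] := epsi.
  split=> //; first by apply: EFin_inj; rewrite -L2sqE.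
  have [k [_ _ H]] := eigenfun_sine_kernel _ _ inj_e e0 b_inj _ _
    (lt0r_neq0 lam0) epsi.
  by exists k; eexists; exact: H.
Qed.

End sine_model.

(** * Orthogonality of the two alternatives and the lower bound *)

Section orthogonal_alternatives.
Context {R : realType}.

(** A null residual is orthogonal to everything, so each function may be replaced by its multiple of
    a wave inside inner products. *)
Lemma ip_near_waves (f g : R -> R) (c c' : R) (a a' : nat) :
  inL2 f -> inL2 g -> (0 < a)%N -> (0 < a')%N -> a != a' ->
  ip (fun t => f t - c * wave a t) (fun t => f t - c * wave a t) = 0 ->
  ip (fun t => g t - c' * wave a' t) (fun t => g t - c' * wave a' t) = 0 ->
  ip f g = 0.
Proof.
move=> Lf Lg a0 a'0 aa' f0 g0.
have Lw := inL2Z c _ (@inL2_wave R a); have Lw' := inL2Z c' _ (@inL2_wave R a').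
have fE h : inL2 h -> ip f h = c * ip (wave a) h.
  move=> Lh; apply/eqP; rewrite -subr_eq0 -ipZl//; last exact: inL2_wave.
  by rewrite -ipBl//; apply/eqP; apply: ip_null => //; exact: inL2B.
have gE h : inL2 h -> ip g h = c' * ip (wave a') h.
  move=> Lh; apply/eqP; rewrite -subr_eq0 -ipZl//; last exact: inL2_wave.
  by rewrite -ipBl//; apply/eqP; apply: ip_null => //; exact: inL2B.
rewrite fE// ipC gE; last exact: inL2_wave.
by rewrite wave_orthonormal// eq_sym (negbTE aa') !mulr0.
Qed.

End orthogonal_alternatives.

Theorem mainTheorem1 (R : realType) (p ell : nat) :
  (4 <= p)%N -> (1 <= ell)%N -> (ell.+1)%:R < (p%:R : R) / 2 ->
  exists c : R, 0 < c /\
  forall (n : nat) (alpha L sigma : R),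
    (1 <= n)%N -> 0 < alpha -> 0 < L -> 0 < sigma ->
  forall F : ('I_n -> 'I_p -> R) -> R -> R, is_estimator F ->
  forall c' : R, c' < c ->
  exists (d : measure_display) (Omega : measurableType d) (P : probability Omega R)
         (X : 'I_n -> Omega -> R -> R) (eps : 'I_n -> 'I_p -> Omega -> R)
         (K : R -> R -> R),
    sampling_model P X eps sigma /\
    (forall i s t, s \in `[0%R, 1%R] -> t \in `[0%R, 1%R] ->
        cov_kernel P (X i) s t = K s t) /\
    in_class alpha L ell K /\
    forall psi : R -> R, ell_th_eigenfun K ell psi ->
      (c'%:E < risk P X eps F psi)%E.
Proof.
move=> p4 ell1 _; have p0 : (0 < p)%N by exact: leq_trans p4.
case: ell ell1 => // N _.
(* The two risks sum to at least 1, so both cannot stay below one half. *)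
exists 2^-1; split; first by rewrite invr_gt0.
move=> n alpha L sigma _ alpha0 L0 _ F eF c' c'lt.
have [d [T [P [Z [mZ PZ]]]]] := independent_family ('I_n + 'I_n * 'I_p)%type
  (fun k => if k is inl _
            then uniform_prob (@ltr01 R) : probability (measurableTypeR R) R
            else normal_prob 0 sigma).
(* Block [h] uses the multiples of [p] with factors [h * N.+1 + 1] to [h * N.+1 + N.+1]: blocks 0
   and 1 are disjoint, and the successor excludes frequency 0. *)
pose e (h : nat) (k : 'I_N.+1) : nat := (p * (k + h * N.+1).+1)%N.
have e0 h k : (0 < e h k)%N by rewrite muln_gt0 p0.
have inj_e h : injective (e h).
  by move=> j k /eqP; rewrite eqn_pmul2l// eqSS eqn_add2r => /eqP /val_inj.
have pe h k : (p %| e h k)%N by exact: dvdn_mulr.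
have e_neq j k : e 0%N j != e 1%N k.
  rewrite eqn_pmul2l// eqSS mul0n addn0 mul1n.
  by rewrite neq_ltn (leq_trans (ltn_ord j))// leq_addl.
pose eps (i : 'I_n) (j : 'I_p) := Z (inr (i, j)).
(* The risk when the data are pure noise, a function of [psi] alone and common to both
   alternatives. *)
pose err psi : \bar R :=
  (\int[P]_w L2sq (fun t => (F (fun i j => eps i j w) t - psi t)%R))%E.
have riskE X psi : (forall i w j, X i w (j%:R / p%:R) = 0) ->
    risk P X eps F psi = err psi.
  move=> X0; apply: eq_integral => w _.
  have -> : observations X eps w = fun i j => eps i j w.
    by apply/funext => i; apply/funext => j; rewrite /observations X0 add0r.
  by [].
have model h := sine_model_exists n p sigma P Z mZ PZ N (e h) alpha L
  (inj_e h) (e0 h) p0 (pe h) alpha0 L0.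
have [X0 [K0 [sm0 cov0 cl0 grid0 eig0]]] := model 0%N.
have [X1 [K1 [sm1 cov1 cl1 grid1 eig1]]] := model 1%N.
(* Either the first alternative works for all its eigenfunctions, or some [psi0] has error at most
   [c']. In the latter case every eigenfunction [psi1] of the second must have error above [c'], as
   [c' + c' < 1]. *)
have [good0|] := pselect (forall psi, ell_th_eigenfun K0 N.+1 psi ->
    (c'%:E < err psi)%E).
  exists d, T, P, X0, eps, K0; split; first exact: sm0.
  split; first by move=> i s t _ _; exact: cov0.
  split; first exact: cl0.
  by move=> psi; rewrite riskE//; exact: good0.
move=> /existsNP[psi0 /not_implyP[psi0P /negP]]; rewrite -leNgt => err0.
exists d, T, P, X1, eps, K1; split; first exact: sm1.
split; first by move=> i s t _ _; exact: cov1.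
split; first exact: cl1.
move=> psi1 psi1P; rewrite riskE//.
have [L20 n0 [k [a near0]]] := eig0 _ psi0P.
have [L21 n1 [k' [a' near1]]] := eig1 _ psi1P.
have o01 := ip_near_waves _ _ _ _ _ _ L20 L21 (e0 _ _) (e0 _ _) (e_neq k k')
  near0 near1.
have sum_ge1 : (1 <= err psi0 + err psi1)%E.
  exact: (two_point_bound n p F P eps psi0 psi1 eF (fun i j => mZ (inr (i, j)))).
rewrite ltNge; apply/negP => err1.
have := le_trans sum_ge1 (leeD err0 err1).
by rewrite -EFinD lee_fin; apply/negP; rewrite -ltNge; lra.
Qed.
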